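(* Let $\mathcal{T} = \langle \mathcal{S},\mathcal{A},p,r,\gamma,\beta,\pi_0\rangle$ be an entropy-regularized task with optimal action-value function $Q^*$, optimal state-value function $V^*$ and optimal policy $\pi^*$. Let $\widetilde{\mathcal{T}}=\langle \mathcal{S},\mathcal{A},q,r,\gamma,\beta,\pi_0\rangle$ be a task differing from $\mathcal{T}$ only in its transition dynamics $q$, with optimal action-value function $\widetilde{Q}^*$, optimal state-value function $\widetilde{V}^*$ and optimal policy $\widetilde{\pi}^*$. Assume that $r=r(s,a)$ does not depend on the next state. Define $$\kappa(s,a) = \gamma\,\mathbb{E}_{s'\sim q(\cdot\mid s,a)}V^*(s') - \gamma\,\mathbb{E}_{s'\sim p(\cdot\mid s,a)}V^*(s'),$$ and let $K^*$ be the optimal action-value function solving the Bellman optimality equation $$K^{*}(s,a) = \kappa(s,a) + \frac{\gamma}{\beta}\,\mathbb{E}_{s'\sim q(\cdot\mid s,a)}\log\mathbb{E}_{a'\sim\pi^*(\cdot\mid s')}e^{\beta K^{*}(s',a')},$$ with corresponding state-value function $V_K^*(s)=\frac1\beta\log\sum_a\pi^*(a\mid s)e^{\beta K^*(s,a)}$ and optimal policy $\pi_K^*(a\mid s)=\pi^*(a\mid s)e^{\beta K^*(s,a)}/e^{\beta V_K^*(s)}$. Then for all $s\in\mathcal{S}$, $a\in\mathcal{A}$: $$\widetilde{Q}^*(s,a) = Q^*(s,a)+K^*(s,a),\qquad \widetilde{V}^*(s)=V^*(s)+V_K^*(s),\qquad \widetilde{\pi}^*(a\mid s)=\pi_K^*(a\mid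 s).$$
   Context: An entropy-regularized task $\langle \mathcal{S},\mathcal{A},p,r,\gamma,\beta,\pi_0\rangle$ consists of discrete (finite or countable) state and action sets $\mathcal{S},\mathcal{A}$, transition dynamics $p(s'\mid s,a)$ (a probability distribution over $s'$ for each $(s,a)$), a bounded reward function $r\colon \mathcal{S}\times\mathcal{A}\times\mathcal{S}\to\mathbb{R}$, a discount factor $\gamma\in(0,1)$, an inverse temperature $\beta>0$, and a prior policy $\pi_0\colon\mathcal{S}\times\mathcal{A}\to(0,1)$ (for each $s$, $\pi_0(\cdot\mid s)$ is a probability distribution on $\mathcal{A}$). The optimal action-value function $Q^*$ of the task is the (unique) bounded solution of the soft Bellman optimality equation $$Q^*(s,a) = \mathbb{E}_{s'\sim p(\cdot\mid s,a)}\left[r(s,a,s') + \frac{\gamma}{\beta}\log \mathbb{E}_{a'\sim\pi_0(\cdot\mid s')} e^{\beta Q^*(s',a')}\right].$$ The optimal state-value function is $V^*(s)=\frac{1}{\beta}\log\sum_a\pi_0(a\mid s)e^{\beta Q^*(s,a)}$, and the optimal policy is $\pi^*(a\mid s)=\pi_0(a\mid s)e^{\beta Q^*(s,a)}/\sum_{a'}\pi_0(a'\mid s)e^{\beta Q^*(s,a')}$. Thus $K^*,V_K^*,\pi_K^*$ are the optimal quantities of the task with dynamics $q$, reward $\kappa$ and prior policy $\pi^*$ (same $\gamma,\beta$); $K^*$ denotes the bounded solution of its equation. *)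

(* Defs.v *)
From mathcomp Require Import all_boot all_order all_algebra.
From mathcomp Require Import boolp classical_sets functions reals ereal.
From mathcomp Require Import topology normedtype sequences esum numfun exp.

Set Implicit Arguments.
Unset Strict Implicit.
Unset Printing Implicit Defensive.
Import Order.TTheory GRing.Theory Num.Theory.

Local Open Scope classical_set_scope.
Local Open Scope ring_scope.

Section Sums.
Context {R : realType} {X : countType}.
Implicit Types (f mu : X -> R).

(* [esum] is meaningful for nonnegative families only, so an absolutely
   summable real family is summed through its positive and negative parts. *)
Definition rsum f : R :=
  fine (\esum_(x in [set: X]) ((EFin \o f)^\+ x)%E)
  - fine (\esum_(x in [set: X]) ((EFin \o f)^\- x)%E).

Definition mean mu f : R := rsum (fun x => mu x * f x).

Definition is_distribution mu : Prop :=
  (forall x, 0 <= mu x) /\ (\esum_(x in [set: X]) (mu x)%:E = 1)%E.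

End Sums.

(* [dyn T s a s'] is p(s' | s, a) and [prior T s a] is pi_0(a | s). *)
Record task (R : realType) (S A : countType) := Task {
  dyn : S -> A -> S -> R;
  rew : S -> A -> S -> R;
  disc : R;
  invtemp : R;
  prior : S -> A -> R }.

Section Tasks.
Context {R : realType} {S A : countType}.
Implicit Types (T : task R S A) (Q : S -> A -> R) (q : S -> A -> S -> R).

Definition is_task T : Prop :=
  [/\ forall s a, is_distribution (dyn T s a),
      exists M, forall s a s', `|rew T s a s'| <= M,
      0 < disc T < 1,
      0 < invtemp T &
      forall s, is_distribution (prior T s) /\
                forall a, 0 < prior T s a < 1].

Definition with_dyn T q : task R S A :=
  Task q (rew T) (disc T) (invtemp T) (prior T).

Definition bounded_Q Q : Prop := exists M, forall s a, `|Q s a| <= M.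

(* Boundedness singles out Q*: the soft Bellman equation has exactly one bounded
   solution. The definitions below that depend on [Q] denote the optimal
   quantities of [T] when [is_optimal_Q T Q] holds. *)
Definition is_optimal_Q T Q : Prop :=
  bounded_Q Q /\
  forall s a, Q s a =
    mean (dyn T s a) (fun s' =>
      rew T s a s' + disc T / invtemp T *
        ln (mean (prior T s') (fun a' => expR (invtemp T * Q s' a')))).

Definition optimal_V T Q (s : S) : R :=
  (invtemp T)^-1 * ln (rsum (fun a => prior T s a * expR (invtemp T * Q s a))).

Definition optimal_pi T Q (s : S) (a : A) : R :=
  prior T s a * expR (invtemp T * Q s a)
  / rsum (fun a' => prior T s a' * expR (invtemp T * Q s a')).

Definition kappa T q Q (s : S) (a : A) : R :=
  disc T * mean (q s a) (optimal_V T Q)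
  - disc T * mean (dyn T s a) (optimal_V T Q).

(* The optimal quantities of the task with dynamics [q], reward [kappa T q Q]
   and prior policy [optimal_pi T Q]. *)
Definition is_optimal_K T q Q (K : S -> A -> R) : Prop :=
  bounded_Q K /\
  forall s a, K s a =
    kappa T q Q s a + disc T / invtemp T *
      mean (q s a) (fun s' =>
        ln (mean (optimal_pi T Q s') (fun a' => expR (invtemp T * K s' a')))).

Definition optimal_VK T Q (K : S -> A -> R) (s : S) : R :=
  (invtemp T)^-1 *
    ln (rsum (fun a => optimal_pi T Q s a * expR (invtemp T * K s a))).

Definition optimal_piK T Q (K : S -> A -> R) (s : S) (a : A) : R :=
  optimal_pi T Q s a * expR (invtemp T * K s a)
  / expR (invtemp T * optimal_VK T Q K s).

End Tasks.

(* Main.v *)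
Require Import Defs.
From mathcomp Require Import all_boot all_order all_algebra.
From mathcomp Require Import boolp classical_sets functions reals ereal.
From mathcomp Require Import topology normedtype sequences esum numfun exp.
From mathcomp Require Import ring lra.

(* Under the prior [pi^*], proportional to [pi_0 * exp (beta Q)], the partition
   function of [K] is the quotient of those of [Q + K] and [Q] under [pi_0],
   hence [V_K = V_{Q+K} - V_Q]. Substituting this in the equation for [K], the
   terms of [kappa] cancel the values of [V_Q] under both dynamics, so that
   [Q + K] solves the Bellman equation for the dynamics [q]. A bounded solution
   is unique because [V] is monotone and commutes with adding constants, so that
   the Bellman operator contracts the sup norm by the discount factor. *)

Set Implicit Arguments.
Unset Strict Implicit.
Unset Printing Implicit Defensive.
Import Order.TTheory GRing.Theory Num.Theory.

Local Open Scope classical_set_scope.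
Local Open Scope ring_scope.

(** * Scaling and domination for sums of extended reals *)

Section ExtendedSums.
Context {R : realType} {X : choiceType}.
Implicit Types (D : set X).

(** For a positive factor, comparing finite partial sums gives one inequality. Applied to the factor
    [c^-1] and the family [c * u], the same inequality gives the converse. *)
Lemma ge0_esumZl D (c : R) (u : X -> \bar R) :
  0 <= c -> (forall x, 0 <= u x)%E ->
  (\esum_(x in D) (c%:E * u x) = c%:E * \esum_(x in D) u x)%E.
Proof.
rewrite le_eqVlt => /predU1P[<-|c0] u0.
  by rewrite mul0e esum1// => x _; rewrite mul0e.
have le (k : R) (v : X -> \bar R) : 0 < k -> (forall x, 0 <= v x)%E ->
    (\esum_(x in D) (k%:E * v x) <= k%:E * \esum_(x in D) v x)%E.
  move=> k0 v0; apply: ge_ereal_sup => _ [F FD <-].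
  rewrite -ge0_mule_fsumr// lee_pmul2l//.
  by apply: esum_ge; exists F.
apply/eqP; rewrite eq_le le//=.
rewrite -(@lee_pmul2l _ c^-1%:E)// ?lte_fin ?invr_gt0//.
rewrite muleA -EFinM mulVf ?gt_eqF// mul1e.
apply: le_trans (le _ (fun x => c%:E * u x)%E _ _); rewrite ?invr_gt0//.
  by apply: le_esum => x _; rewrite muleA -EFinM mulVf ?gt_eqF// mul1e.
by move=> x; rewrite mule_ge0// lee_fin ltW.
Qed.

Lemma summableZl D (c : R) (u : X -> \bar R) :
  summable D u -> summable D (fun x => c%:E * u x)%E.
Proof.
move=> Du; rewrite /summable (eq_esum (b := fun x => (`|c|%:E * `|u x|)%E)).
  rewrite ge0_esumZl// lte_mul_pinfty ?lee_fin//.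
by move=> x _; rewrite abseM.
Qed.

Lemma le_summable D (u v : X -> \bar R) :
  (forall x, D x -> `|u x| <= `|v x|)%E -> summable D v -> summable D u.
Proof. by move=> uv; apply: le_lt_trans; exact: le_esum. Qed.

Lemma ge0_esum_fin_num D (u : X -> \bar R) : (forall x, D x -> 0 <= u x)%E ->
  summable D u -> esum D u \is a fin_num.
Proof.
move=> u0; rewrite summableE; congr (_ \is a fin_num).
by apply: eq_esum => x Dx; rewrite gee0_abs ?u0.
Qed.

End ExtendedSums.

(** * Linearity and monotonicity of real sums, then means and free energies *)

Section RealSums.
Context {R : realType} {X : countType}.
Implicit Types (f g mu : X -> R).

Local Notation summable f := (summable [set: X] (EFin \o f)).

Lemma ge0_rsumE f : (forall x, 0 <= f x) ->
  rsum f = fine (\esum_(x in [set: X]) (f x)%:E).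
Proof.
move=> f0; rewrite /rsum [X in _ - X](_ : _ = 0) ?subr0.
  congr fine; apply: eq_esum => x _.
  by rewrite funeposE; apply/max_idPl; rewrite lee_fin.
rewrite esum1// => x _; rewrite funenegE; apply/max_idPr.
by rewrite leeNl oppe0 lee_fin.
Qed.

Lemma rsum_ge0 f : (forall x, 0 <= f x) -> 0 <= rsum f.
Proof.
by move=> f0; rewrite ge0_rsumE// fine_ge0// esum_ge0// => x _; rewrite lee_fin.
Qed.

Lemma ge0_rsumD f g : (forall x, 0 <= f x) -> (forall x, 0 <= g x) ->
  summable f -> summable g ->
  rsum (fun x => f x + g x) = rsum f + rsum g.
Proof.
move=> f0 g0 sf sg; rewrite !ge0_rsumE// => [|x]; last exact: addr_ge0.
rewrite -fineD ?ge0_esum_fin_num//; try by move=> x _; rewrite lee_fin.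
congr fine; rewrite -(esumD (a := EFin \o f) (b := EFin \o g))// => x _.
- by rewrite lee_fin.
- by rewrite lee_fin.
Qed.

(** [esumB] already speaks of the positive and negative parts of the difference, which is the shape
    of [rsum]; summability lets [fine] pass through. *)
Lemma ge0_rsumB f g : (forall x, 0 <= f x) -> (forall x, 0 <= g x) ->
  summable f -> summable g ->
  rsum (fun x => f x - g x) = rsum f - rsum g.
Proof.
move=> f0 g0 sf sg; rewrite (ge0_rsumE f0) (ge0_rsumE g0).
rewrite -fineB ?ge0_esum_fin_num//; try by move=> x _; rewrite lee_fin.
have := esumB sf sg (fun x _ => f0 x) (fun x _ => g0 x).
have sfg := summableB sf sg.
by rewrite /rsum => <-; rewrite fineB//; apply: ge0_esum_fin_num => //;
  [exact: summable_funepos | exact: summable_funeneg].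
Qed.

(* Shifting by [g] reduces additivity of [rsum] to nonnegative families. *)
Lemma rsum_shift f g : (forall x, 0 <= g x) ->
  (forall x, - g x <= f x) -> summable f -> summable g ->
  rsum f = rsum (fun x => f x + g x) - rsum g.
Proof.
move=> g0 fg sf sg; rewrite -ge0_rsumB//.
- by congr rsum; apply/funext => x; rewrite addrK.
- by move=> x; rewrite -lerBlDr sub0r.
- exact: (summableD sf sg).
Qed.

Lemma rsumD f g : summable f -> summable g ->
  rsum (fun x => f x + g x) = rsum f + rsum g.
Proof.
have sn (h : X -> R) : summable h -> summable (fun x => `|h x|).
  by apply: le_summable => x _ /=; rewrite lee_fin normr_id.
move=> sf sg; have [sf' sg'] := (sn f sf, sn g sg).
have nf (h : X -> R) x : - `|h x| <= h x by rewrite lerNl -normrN ler_norm.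
(* With this shift the sum regroups as [(f + |f|) + (g + |g|)], where both families are
   nonnegative. *)
rewrite (rsum_shift (g := fun x => `|f x| + `|g x|)).
- rewrite (rsum_shift _ (nf f) sf sf')// (rsum_shift _ (nf g) sg sg')//.
  rewrite (ge0_rsumD (f := fun x => `|f x|))//.
  rewrite (_ : (fun x => f x + g x + (`|f x| + `|g x|)) =
               (fun x => (f x + `|f x|) + (g x + `|g x|))).
    rewrite ge0_rsumD; first by lra.
    - by move=> x; rewrite -lerBlDr sub0r.
    - by move=> x; rewrite -lerBlDr sub0r.
    - exact: (summableD sf sf').
    - exact: (summableD sg sg').
  by apply/funext => x; rewrite addrACA.
- by move=> x; rewrite addr_ge0.
- by move=> x; rewrite opprD lerD.
- exact: (summableD sf sg).
- exact: (summableD sf' sg').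
Qed.

Lemma rsumN f : rsum (fun x => - f x) = - rsum f.
Proof.
rewrite /rsum opprB; congr (fine _ - fine _); apply: eq_esum => x _.
- by rewrite funeposE funenegE.
- by rewrite funeposE funenegE /= opprK.
Qed.

(** A nonnegative factor commutes with positive and negative parts; a negative one is reduced to its
    opposite by [rsumN]. *)
Lemma rsumZl (c : R) f : summable f -> rsum (fun x => c * f x) = c * rsum f.
Proof.
move=> sf; have pos (k : R) : 0 <= k -> rsum (fun x => k * f x) = k * rsum f.
  move=> k0; rewrite /rsum mulrBr; congr (_ - _).
  - rewrite (eq_esum (b := fun x => (k%:E * (EFin \o f)^\+ x)%E)).
      by rewrite ge0_esumZl// fineM// ge0_esum_fin_num//; exact: summable_funepos.
    by move=> x _; exact: (congr1 (fun h => h x) (ge0_funeposM (EFin \o f) k0)).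
  - rewrite (eq_esum (b := fun x => (k%:E * (EFin \o f)^\- x)%E)).
      by rewrite ge0_esumZl// fineM// ge0_esum_fin_num//; exact: summable_funeneg.
    by move=> x _; exact: (congr1 (fun h => h x) (ge0_funenegM (EFin \o f) k0)).
have [/pos//|/ltW c0] := leP 0 c.
rewrite -[c in RHS]opprK mulNr -pos ?oppr_ge0// -rsumN.
by congr rsum; apply/funext => x; rewrite mulNr opprK.
Qed.

Lemma le_rsum f g : (forall x, f x <= g x) -> summable f -> summable g ->
  rsum f <= rsum g.
Proof.
move=> fg sf sg; have sN : summable (fun x => - f x) by rewrite summableN in sf.
rewrite -subr_ge0 -rsumN -rsumD// rsum_ge0// => x.
by rewrite subr_ge0.
Qed.

(** * Means of bounded functions under a distribution *)

Lemma distribution_summable mu f (M : R) : is_distribution mu ->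
  (forall x, `|f x| <= M) -> summable (fun x => mu x * f x).
Proof.
move=> [mu0 mu1] fM.
(* The dominating family is a multiple of [mu], which has mass one; comparing absolute values avoids
   a sign condition on [M]. *)
apply: (le_summable (v := fun x => (M%:E * (mu x)%:E)%E)).
  move=> x _; rewrite /= lee_fin !normrM mulrC ler_pM//.
  exact: le_trans (fM x) (ler_norm M).
apply: summableZl.
rewrite /esum.summable (eq_esum (b := fun x => (mu x)%:E)) ?mu1 ?ltry//.
by move=> x _; rewrite gee0_abs ?lee_fin.
Qed.

Lemma meanD mu f g (M N : R) : is_distribution mu ->
  (forall x, `|f x| <= M) -> (forall x, `|g x| <= N) ->
  mean mu (fun x => f x + g x) = mean mu f + mean mu g.
Proof.
move=> dmu fM gN; rewrite /mean -rsumD; last 2 first.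
- exact: distribution_summable fM.
- exact: distribution_summable gN.
by congr rsum; apply/funext => x; rewrite mulrDr.
Qed.

Lemma meanZl mu f (c M : R) : is_distribution mu -> (forall x, `|f x| <= M) ->
  mean mu (fun x => c * f x) = c * mean mu f.
Proof.
move=> dmu fM; rewrite /mean -rsumZl; last exact: distribution_summable fM.
by congr rsum; apply/funext => x; rewrite mulrCA.
Qed.

Lemma mean_cst mu (c : R) : is_distribution mu -> mean mu (fun=> c) = c.
Proof.
move=> dmu; have -> : (fun=> c) = (fun _ : X => c * 1) by rewrite mulr1.
rewrite (@meanZl _ _ _ 1)//; last by move=> x; rewrite normr1.
case: dmu => mu0 mu1; rewrite /mean ge0_rsumE => [|x]; last by rewrite mulr1.
rewrite (eq_esum (b := fun x => (mu x)%:E)) ?mu1/= ?mulr1// => x _.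
by rewrite mulr1.
Qed.

Lemma le_mean mu f g (M N : R) : is_distribution mu ->
  (forall x, `|f x| <= M) -> (forall x, `|g x| <= N) ->
  (forall x, f x <= g x) -> mean mu f <= mean mu g.
Proof.
move=> dmu fM gN fg; apply: le_rsum.
- by move=> x; apply: ler_wpM2l (fg x); case: dmu.
- exact: distribution_summable fM.
- exact: distribution_summable gN.
Qed.

Lemma mean_shift mu f g (M N D : R) : is_distribution mu ->
  (forall x, `|f x| <= M) -> (forall x, `|g x| <= N) ->
  (forall x, f x <= g x + D) -> mean mu f <= mean mu g + D.
Proof.
move=> dmu fM gN fg; rewrite -[D in leRHS](mean_cst D dmu).
rewrite -(meanD dmu gN (fun=> lexx `|D|)).
apply: (le_mean dmu fM _ fg) => x.
by apply: le_trans (ler_normD _ _) _; exact: lerD (gN x) (lexx _).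
Qed.

(** The scaled log-partition function. [optimal_V T Q s] is convertible to its value at [prior T s],
    [invtemp T] and [Q s], so the lemmas below apply to [optimal_V] directly. *)
Definition free_energy mu (b : R) f : R :=
  b^-1 * ln (mean mu (fun x => expR (b * f x))).

Lemma norm_expR_le (b M : R) f : 0 < b -> (forall x, `|f x| <= M) ->
  forall x, `|expR (b * f x)| <= expR (b * M).
Proof.
move=> b0 fM x; rewrite ger0_norm ?expR_ge0// ler_expR ler_pM2l//.
exact: le_trans (ler_norm _) (fM x).
Qed.

(** The integrand is at least the positive constant [expR (- (b * M))]. Positivity is what allows
    [lnK] and [ln_div] on partition functions. *)
Lemma mean_expR_gt0 mu (b M : R) f : is_distribution mu -> 0 < b ->
  (forall x, `|f x| <= M) -> 0 < mean mu (fun x => expR (b * f x)).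
Proof.
move=> dmu b0 fM; apply: lt_le_trans (expR_gt0 (- (b * M))) _.
rewrite -[leLHS](mean_cst _ dmu).
apply: (le_mean dmu (fun=> lexx `|expR (- (b * M))|) (norm_expR_le b0 fM)) => x.
rewrite ler_expR -mulrN ler_pM2l// lerNl.
by apply: le_trans (fM x); rewrite -normrN ler_norm.
Qed.

(** After exponentiation the shift [D] becomes the constant factor [expR (b * D)], which enters the
    mean; the integrands then compare pointwise. *)
Lemma free_energy_shift mu (b M N D : R) f g : is_distribution mu -> 0 < b ->
  (forall x, `|f x| <= M) -> (forall x, `|g x| <= N) ->
  (forall x, f x <= g x + D) ->
  free_energy mu b f <= free_energy mu b g + D.
Proof.
move=> dmu b0 fM gN fg.
have Zf := mean_expR_gt0 dmu b0 fM; have Zg := mean_expR_gt0 dmu b0 gN.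
rewrite -(ler_pM2l b0) mulrDr /free_energy !mulVKf ?gt_eqF//.
rewrite -ler_expR expRD !lnK// mulrC -(meanZl _ dmu (norm_expR_le b0 gN)).
apply: (le_mean (N := expR (b * D) * expR (b * N)) dmu (norm_expR_le b0 fM)).
  move=> x; rewrite normrM ger0_norm ?expR_ge0// ler_pM2l ?expR_gt0//.
  exact: norm_expR_le.
by move=> x; rewrite -expRD ler_expR -mulrDr ler_pM2l// addrC.
Qed.

(** The zero function has free energy zero and lies within [M] of [f] on both sides. *)
Lemma free_energy_bound mu (b M : R) f : is_distribution mu -> 0 < b ->
  (forall x, `|f x| <= M) -> `|free_energy mu b f| <= M.
Proof.
move=> dmu b0 fM.
have F0 : free_energy mu b (fun=> 0) = 0.
  by rewrite /free_energy mulr0 expR0 mean_cst// ln1 mulr0.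
have z0 (x : X) : `|0 : R| <= 0 by rewrite normr0.
rewrite ler_norml; apply/andP; split.
- rewrite -subr_ge0 opprK -[leLHS]F0; apply: (free_energy_shift dmu b0 z0 fM) => x.
  by rewrite -lerBlDr sub0r; have := fM x; rewrite ler_norml => /andP[].
- rewrite -[leRHS]add0r -[X in _ <= X + _]F0.
  apply: (free_energy_shift dmu b0 fM z0) => x.
  by rewrite add0r; have := fM x; rewrite ler_norml => /andP[].
Qed.

End RealSums.

(** * The soft Bellman equation: uniqueness, then change of prior and dynamics *)

Section SoftBellman.
Context {R : realType} {S A : countType}.
Implicit Types (T : task R S A) (Q K : S -> A -> R) (q : S -> A -> S -> R).

Lemma optimal_QE T Q : is_optimal_Q T Q -> forall s a,
  Q s a = mean (dyn T s a) (fun s' => rew T s a s' + disc T * optimal_V T Q s').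
Proof.
move=> [_ QE] s a; rewrite QE; congr mean; apply/funext => s'.
by rewrite mulrA.
Qed.

Lemma optimal_V_bound T Q (M : R) : is_task T -> (forall s a, `|Q s a| <= M) ->
  forall s, `|optimal_V T Q s| <= M.
Proof.
move=> [_ _ _ b0 dpi] QM s; have [dpis _] := dpi s.
exact: (free_energy_bound dpis b0 (QM s)).
Qed.

(** The shift [D] passes unchanged through [optimal_V] and through the mean; only the discount
    scales it. The one-sided form is used in both directions for uniqueness. *)
Lemma le_optimal_Q_contraction T Q1 Q2 (D : R) : is_task T ->
  is_optimal_Q T Q1 -> is_optimal_Q T Q2 ->
  (forall s a, Q1 s a <= Q2 s a + D) ->
  forall s a, Q1 s a <= Q2 s a + disc T * D.
Proof.
move=> tT o1 o2 Q12 s a; rewrite (optimal_QE o1) (optimal_QE o2).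
have [[M1 QM1] _] := o1; have [[M2 QM2] _] := o2.
have [dp [M rM] /andP[g0 _] b0 dpi] := tT.
have bnd N Q : (forall s a, `|Q s a| <= N) -> forall s',
    `|rew T s a s' + disc T * optimal_V T Q s'| <= M + disc T * N.
  move=> QN s'; apply: le_trans (ler_normD _ _) (lerD (rM _ _ _) _).
  by rewrite normrM gtr0_norm// ler_pM2l// optimal_V_bound.
apply: (mean_shift (dp s a) (bnd _ _ QM1) (bnd _ _ QM2)) => s'.
rewrite -addrA -mulrDr lerD2l ler_pM2l//.
have [dpis _] := dpi s'.
exact: (free_energy_shift dpis b0 (QM1 s') (QM2 s')).
Qed.

Lemma optimal_Q_unique T Q1 Q2 : is_task T ->
  is_optimal_Q T Q1 -> is_optimal_Q T Q2 -> forall s a, Q1 s a = Q2 s a.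
Proof.
move=> tT o1 o2 s0 a0.
(* The sup distance is [sup E]: the given pair makes [E] nonempty and the boundedness of [Q1] and
   [Q2] bounds it above. *)
pose E : set R := [set `|Q1 p.1 p.2 - Q2 p.1 p.2| | p in [set: S * A]].
have E0 : E !=set0 by exists `|Q1 s0 a0 - Q2 s0 a0|; exists (s0, a0).
have hE : has_ubound E.
  have [[[M1 QM1] _] [[M2 QM2] _]] := (o1, o2).
  exists (M1 + M2) => _ [[s a] _ <-] /=.
  by apply: le_trans (ler_normB _ _) (lerD _ _).
have le_supE s a : `|Q1 s a - Q2 s a| <= sup E.
  by apply: ub_le_sup => //; exists (s, a).
(* The contraction is taken both ways with [D] equal to [sup E]; a discount below one then forces
   [sup E <= 0]. *)
have : sup E <= disc T * sup E.
  apply: ge_sup => // _ [[s a] _ <-] /=; rewrite ler_norml; apply/andP; split.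
  - rewrite lerNl opprB lerBlDl.
    apply: (le_optimal_Q_contraction tT o2 o1) => s' a'.
    rewrite -lerBlDl -opprB lerNl.
    by have := le_supE s' a'; rewrite ler_norml => /andP[].
  - rewrite lerBlDl; apply: (le_optimal_Q_contraction tT o1 o2) => s' a'.
    by rewrite -lerBlDl; exact: le_trans (ler_norm _) (le_supE _ _).
have [_ _ /andP[_ g1] _ _] := tT.
move=> supE; have : sup E <= 0 by nra.
by move=> /(le_trans (le_supE s0 a0)); rewrite normr_le0 subr_eq0 => /eqP.
Qed.

(** The normalizer of [optimal_pi] does not depend on the action, so it comes out of the sum, and
    the two exponentials merge. *)
Lemma mean_optimal_pi T Q K s : is_task T -> bounded_Q Q -> bounded_Q K ->
  mean (optimal_pi T Q s) (fun a => expR (invtemp T * K s a)) =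
  mean (prior T s) (fun a => expR (invtemp T * (Q s a + K s a)))
  / mean (prior T s) (fun a => expR (invtemp T * Q s a)).
Proof.
move=> [_ _ _ b0 dpi] [M QM] [N KN]; have [dpis _] := dpi s.
have QKMN a : `|Q s a + K s a| <= M + N.
  by rewrite (le_trans (ler_normD _ _)) ?lerD.
rewrite mulrC -(meanZl _ dpis (norm_expR_le b0 QKMN)).
congr rsum; apply/funext => a.
by rewrite mulrDr expRD /optimal_pi /mean; ring.
Qed.

Lemma optimal_VK_sub T Q K s : is_task T -> bounded_Q Q -> bounded_Q K ->
  optimal_VK T Q K s =
  optimal_V T (fun s a => Q s a + K s a) s - optimal_V T Q s.
Proof.
move=> tT bQ bK; have [[M QM] [N KN]] := (bQ, bK).
have [_ _ _ b0 dpi] := tT; have [dpis _] := dpi s.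
have QKMN a : `|Q s a + K s a| <= M + N.
  by rewrite (le_trans (ler_normD _ _)) ?lerD.
rewrite -[LHS]/(_ * ln (mean _ _)) mean_optimal_pi// ln_div ?mulrBr//.
- exact: mean_expR_gt0 QKMN.
- exact: mean_expR_gt0 (QM s).
Qed.

Lemma is_optimal_QD T q Q K : is_task T -> is_task (with_dyn T q) ->
  (forall s a s1 s2, rew T s a s1 = rew T s a s2) ->
  is_optimal_Q T Q -> is_optimal_K T q Q K ->
  is_optimal_Q (with_dyn T q) (fun s a => Q s a + K s a).
Proof.
move=> tT tTt rew_next oQ [bK KE]; have [bQ _] := oQ.
have [[M QM] [N KN]] := (bQ, bK).
have QKMN s a : `|Q s a + K s a| <= M + N.
  by rewrite (le_trans (ler_normD _ _)) ?lerD.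
split; first by exists (M + N).
(* Any state can stand for the next one, as the reward ignores it; [s] is at hand. *)
move=> s a; pose r := rew T s a s.
pose W := optimal_V T (fun s a => Q s a + K s a).
have [dp [B rB] _ b0 _] := tT; have [dq _ _ _ _] := tTt.
have VM := optimal_V_bound tT QM; have WMN := optimal_V_bound tT QKMN.
have gbnd (g : R) (f : S -> R) C : (forall x, `|f x| <= C) ->
    forall x, `|g * f x| <= `|g| * C.
  by move=> fC x; rewrite normrM ler_wpM2l.
have meanr (mu f : S -> R) C : is_distribution mu -> (forall x, `|f x| <= C) ->
    mean mu (fun s' => rew T s a s' + disc T * f s') = r + disc T * mean mu f.
  move=> dmu fC; rewrite (meanD dmu (rB s a) (gbnd _ _ _ fC)) (meanZl _ dmu fC).
  congr (_ + _); rewrite -[RHS](mean_cst _ dmu); congr mean.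
  by apply/funext => s'; exact: rew_next.
transitivity (r + disc T * mean (q s a) W); last first.
  rewrite -(meanr _ _ _ (dq s a) WMN); congr mean; apply/funext => s'.
  by rewrite mulrA.
rewrite (optimal_QE oQ) (meanr _ _ _ (dp s a) VM) KE /kappa.
(* The factor [invtemp T] will cancel the division in the equation for [K]; the difference is
   written with [-1 *] so that [meanD] and [meanZl] apply. *)
have lnE : (fun s' => ln (mean (optimal_pi T Q s')
    (fun a' => expR (invtemp T * K s' a')))) =
    (fun s' => invtemp T * (W s' + -1 * optimal_V T Q s')).
  apply/funext => s'; rewrite mulN1r -optimal_VK_sub// /optimal_VK mulVKf//.
  by rewrite gt_eqF.
have WV x : `|W x + -1 * optimal_V T Q x| <= (M + N) + `|-1 : R| * M.
  by apply: le_trans (ler_normD _ _) (lerD (WMN x) (gbnd _ _ _ VM x)).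
rewrite lnE (meanZl _ (dq s a) WV) mulrA divfK ?gt_eqF//.
rewrite (meanD (dq s a) WMN (gbnd _ _ _ VM)) (meanZl _ (dq s a) VM).
(* With the three means as atoms, the means of [optimal_V T Q] under [dyn T] and under [q]
   cancel. *)
move: (mean (dyn T s a) _) (mean (q s a) (optimal_V T Q)) (mean (q s a) W).
by move=> *; ring.
Qed.

End SoftBellman.

Theorem theorem8 (R : realType) (S A : countType) (T : task R S A)
    (q : S -> A -> S -> R) (Q Qt K : S -> A -> R)
    (T_task : is_task T) (Tt_task : is_task (with_dyn T q))
    (Q_opt : is_optimal_Q T Q) (Qt_opt : is_optimal_Q (with_dyn T q) Qt)
    (rew_next : forall s a s1 s2, rew T s a s1 = rew T s a s2)
    (K_opt : is_optimal_K T q Q K) :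
  [/\ forall s a, Qt s a = Q s a + K s a,
      forall s, optimal_V (with_dyn T q) Qt s =
                optimal_V T Q s + optimal_VK T Q K s &
      forall s a, optimal_pi (with_dyn T q) Qt s a = optimal_piK T Q K s a].
Proof.
have [[bQ _] [bK _]] := (Q_opt, K_opt).
have QtE : Qt = fun s a => Q s a + K s a.
  apply/funext => s; apply/funext => a.
  exact: (optimal_Q_unique Tt_task Qt_opt
    (is_optimal_QD T_task Tt_task rew_next Q_opt K_opt)).
have VKE s := optimal_VK_sub s T_task bQ bK.
split=> [s a|s|s a]; first by rewrite QtE.
  by rewrite VKE QtE addrC subrK.
have [_ _ _ b0 dpi] := T_task; have [dpis _] := dpi s.
have [[M QM] [N KN]] := (bQ, bK).
have Z0 := mean_expR_gt0 dpis b0 (QM s).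
have QKMN a' : `|Q s a' + K s a'| <= M + N.
  by rewrite (le_trans (ler_normD _ _)) ?lerD.
have W0 := mean_expR_gt0 dpis b0 QKMN.
have -> : optimal_pi (with_dyn T q) Qt s a =
    prior T s a * (expR (invtemp T * Q s a) * expR (invtemp T * K s a))
    / mean (prior T s) (fun a' => expR (invtemp T * (Q s a' + K s a'))).
  by rewrite QtE -expRD -mulrDr.
(* The denominator of [optimal_piK] is the partition function of [K] under [optimal_pi], hence a
   quotient; its lower part cancels the normalizer of [optimal_pi]. *)
have -> : optimal_piK T Q K s a =
    prior T s a * expR (invtemp T * Q s a)
    / mean (prior T s) (fun a' => expR (invtemp T * Q s a'))
    * expR (invtemp T * K s a)
    / (mean (prior T s) (fun a' => expR (invtemp T * (Q s a' + K s a')))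
       / mean (prior T s) (fun a' => expR (invtemp T * Q s a'))).
  rewrite -mean_optimal_pi// /optimal_piK /optimal_VK mulVKf ?gt_eqF// lnK//.
  by rewrite posrE -[ltRHS]/(mean _ _) mean_optimal_pi// divr_gt0.
by field; rewrite !gt_eqF.
Qed.
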